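(* Let $A \in \mathcal{H}_{\alpha}(\mathbb{R}^{\mathbb{N}})$. If the family of Gibbs states $(\mu_{\beta A})_{\beta>0}$ has an accumulation point $\mu_{\infty}$ at infinity (i.e. $\mu_\infty$ is a Borel probability measure on $\mathbb{R}^{\mathbb{N}}$ and there is a sequence $\beta_n\to+\infty$ with $\mu_{\beta_n A}\to\mu_\infty$ weakly), then $\mu_\infty$ is an $A$-maximizing probability measure.
   Context: Points of $\mathbb{R}^{\mathbb{N}}$ are $x=(x_1,x_2,\ldots)$; $\sigma$ is the left shift; $ax=(a,x_1,x_2,\ldots)$. The metric on $\mathbb{R}^{\mathbb{N}}$ is $d(x,y)=\sum_{n\ge 1}\frac{1}{\pi 2^n}|\arctan(x_n)-\arctan(y_n)|$. $\mathcal{H}_\alpha(\mathbb{R}^{\mathbb{N}})$ is the set of real-valued $\alpha$-Hölder functions for $d$ (exponent $\alpha\in(0,1]$ fixed). Fix a strictly positive continuous $f:\mathbb{R}\to\mathbb{R}$ with $\int_{\mathbb{R}} f(a)\,da=1$. For $B\in\mathcal{H}_\alpha(\mathbb{R}^{\mathbb{N}})$ the Ruelle operator is $\mathcal{L}_B(\varphi)(x)=\int_{\mathbb{R}} e^{B(ax)}\varphi(ax)f(a)\,da$, with dual $\int\varphi\, d(\mathcal{L}_B^*\mu)=\int\mathcal{L}_B(\varphi)\,d\mu$ for bounded continuous $\varphi$. There are $\lambda_B>0$ (simple) and a strictly positive $\alpha$-Hölder $\psi_B$ with $\mathcal{L}_B\psi_B=\lambda_B\psi_B$; with $\bar B=B+\log\psi_B-\log(\psi_B\circ\sigma)-\log\lambda_B$,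 the Gibbs state $\mu_B$ is the unique $\sigma$-invariant Borel probability measure on $\mathbb{R}^{\mathbb{N}}$ with $\mathcal{L}_{\bar B}^*\mu_B=\mu_B$. This is applied with $B=\beta A$, $\beta>0$. An $A$-maximizing probability measure is a $\sigma$-invariant Borel probability $\mu$ on $\mathbb{R}^{\mathbb{N}}$ with $\int A\,d\mu=m(A)$, where $m(A)=\sup\{\int A\,d\eta:\eta\ \sigma\text{-invariant Borel probability on }\mathbb{R}^{\mathbb{N}}\}$. *)

(* Defs.v *)
From HB Require Import structures.
From mathcomp Require Import all_boot all_order all_algebra.
From mathcomp Require Import all_classical all_reals all_analysis.
From mathcomp Require Import lra.

Set Implicit Arguments.
Unset Strict Implicit.
Unset Printing Implicit Defensive.

Import Order.TTheory GRing.Theory Num.Theory.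
Import numFieldNormedType.Exports.

Local Open Scope classical_set_scope.
Local Open Scope ring_scope.

(* Sequences are indexed from 0: the coordinate x_n (n >= 1) is [x n.-1].  The
   alias blocks the library's product topology on [nat -> R], so that the
   topology of [seqsp R] is the one defined by the metric [sdist] below. *)
Definition seqsp (R : realType) : Type := nat -> R.

HB.instance Definition _ (R : realType) := Pointed.copy (seqsp R) (nat -> R).

Definition shift (R : realType) (x : seqsp R) : seqsp R := fun n => x n.+1.

Definition scons (R : realType) (a : R) (x : seqsp R) : seqsp R :=
  fun n => if n is m.+1 then x m else a.

Section metric.
Context {R : realType}.
Implicit Types x y z : seqsp R.

Definition sdist_term x y (n : nat) : R :=
  (pi * 2 ^+ n.+1)^-1 * `|atan (x n) - atan (y n)|.

Definition sdist x y : R := limn (series (sdist_term x y)).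

Let weight_gt0 n : 0 < (pi * 2 ^+ n.+1)^-1 :> R.
Proof. by rewrite invr_gt0 mulr_gt0 ?pi_gt0// exprn_gt0. Qed.

Let term_ge0 x y n : 0 <= sdist_term x y n.
Proof. by rewrite mulr_ge0// ltW// weight_gt0. Qed.

Lemma sdist_term_le x y n : sdist_term x y n <= geometric 2^-1 2^-1 n.
Proof.
rewrite /sdist_term /geometric/= -exprS exprVn invfM mulrAC.
rewrite ler_piMl ?invr_ge0 ?exprn_ge0//.
rewrite mulrC ler_pdivrMr ?pi_gt0// mul1r.
have := @atan_gtNpi2 R (x n); have := @atan_ltpi2 R (x n).
have := @atan_gtNpi2 R (y n); have := @atan_ltpi2 R (y n).
by rewrite ler_norml => *; apply/andP; split; lra.
Qed.

Lemma is_cvg_sdist x y : cvgn (series (sdist_term x y)).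
Proof.
apply: (@series_le_cvg _ _ (geometric 2^-1 2^-1)) => //.
- by move=> n; rewrite /geometric/= mulr_ge0// exprn_ge0.
- exact: sdist_term_le.
- apply: is_cvg_geometric_series.
  by rewrite ger0_norm ?invr_ge0// invf_lt1 ?ltr1n.
Qed.

Lemma sdist_term_le_sdist x y n : sdist_term x y n <= sdist x y.
Proof.
have nd : nondecreasing_seq (series (sdist_term x y)).
  by apply: nondecreasing_series => i _ _; exact: term_ge0.
have h := nondecreasing_cvgn_le nd (@is_cvg_sdist x y) n.+1.
apply: le_trans h; rewrite /series/= big_nat_recr//= lerDr.
by apply: sumr_ge0.
Qed.

Lemma sdistxx x : sdist x x = 0.
Proof.
rewrite /sdist (_ : series _ = fun=> 0); first exact: lim_cst.
apply/funext => n; rewrite /series/= big1// => i _.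
by rewrite /sdist_term subrr normr0 mulr0.
Qed.

Lemma sdist_positivity x y : sdist x y = 0 -> x = y.
Proof.
move=> xy0; apply/funext => n.
have := sdist_term_le_sdist x y n; rewrite xy0 /sdist_term.
rewrite pmulr_rle0 ?weight_gt0// normr_le0 subr_eq0 => /eqP xy.
by rewrite -(atanK (x n)) xy atanK.
Qed.

Lemma sdistC x y : sdist x y = sdist y x.
Proof.
rewrite /sdist (_ : sdist_term x y = sdist_term y x)//.
by apply/funext => n; rewrite /sdist_term distrC.
Qed.

Lemma sdist_triangle y x z : sdist x z <= sdist x y + sdist y z.
Proof.
rewrite /sdist -lim_seriesD; [|exact: is_cvg_sdist..].
apply: lim_series_le.
- exact: is_cvg_sdist.
- by apply: is_cvg_seriesD; exact: is_cvg_sdist.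
- move=> n; rewrite /sdist_term/= /GRing.add/= -mulrDr.
  by rewrite ler_wpM2l ?(ltW (weight_gt0 _))// ler_distD.
Qed.

HB.instance Definition _ := isMetric.Build R (seqsp R)
  sdistxx sdist_positivity sdistC sdist_triangle.

End metric.

(* The Borel sigma-algebra of the metric space [seqsp R]. *)
Definition borel_seqsp (R : realType) := g_sigma_algebraType (@open (seqsp R)).

Section definitions.
Context {R : realType}.
Local Notation leb := (@lebesgue_measure R).

Definition hoelder_fun (alpha : R) (phi : seqsp R -> R) : Prop :=
  exists C : R, forall x y, `|phi x - phi y| <= C * mdist x y `^ alpha.

Definition bounded_continuous (phi : seqsp R -> R) : Prop :=
  continuous phi /\ exists M : R, forall x, `|phi x| <= M.

Definition ruelle (f : R -> R) (B phi : seqsp R -> R) (x : seqsp R) : R :=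
  \int[leb]_a (expR (B (scons a x)) * phi (scons a x) * f a).

(* [is_dual_ruelle f B mu nu] says that nu = L_B^* mu. *)
Definition is_dual_ruelle (f : R -> R) (B : seqsp R -> R)
    (mu nu : {measure set (borel_seqsp R) -> \bar R}) : Prop :=
  forall phi, bounded_continuous phi ->
    \int[nu]_x phi x = \int[mu]_x ruelle f B phi x.

Definition shift_invariant (mu : probability (borel_seqsp R) R) : Prop :=
  forall U : set (borel_seqsp R), measurable U ->
    mu (@shift R @^-1` U) = mu U.

Definition normalized_potential (B : seqsp R -> R) (lambda : R)
    (psi : seqsp R -> R) (x : seqsp R) : R :=
  B x + ln (psi x) - ln (psi (shift x)) - ln lambda.

Definition main_eigenpair (alpha : R) (f : R -> R) (B : seqsp R -> R)
    (lambda : R) (psi : seqsp R -> R) : Prop :=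
  [/\ 0 < lambda, forall x, 0 < psi x, hoelder_fun alpha psi
    & forall x, ruelle f B psi x = lambda * psi x].

(* Only the defining property of the Gibbs state is recorded.  Simplicity of
   the eigenvalue and uniqueness of [mu] are theorems about Hoelder potentials,
   not part of the definition. *)
Definition gibbs_state (alpha : R) (f : R -> R) (B : seqsp R -> R)
    (mu : probability (borel_seqsp R) R) : Prop :=
  shift_invariant mu /\
  exists lambda psi, main_eigenpair alpha f B lambda psi /\
    is_dual_ruelle f (normalized_potential B lambda psi) mu mu.

Definition weak_cvg (mu_ : nat -> probability (borel_seqsp R) R)
    (mu : probability (borel_seqsp R) R) : Prop :=
  forall phi : seqsp R -> R, bounded_continuous phi ->
    (\int[mu_ n]_x phi x) @[n --> \oo] --> \int[mu]_x phi x.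

Definition accumulation_at_infinity
    (mu_ : R -> probability (borel_seqsp R) R)
    (mu : probability (borel_seqsp R) R) : Prop :=
  exists beta : nat -> R, [/\ forall n, 0 < beta n,
    beta n @[n --> \oo] --> +oo%R & weak_cvg (fun n => mu_ (beta n)) mu].

(* Hoelder functions are bounded because [sdist] is, so for such [A] the
   supremum is that of a nonempty bounded set of reals. *)
Definition max_integral (A : seqsp R -> R) : R :=
  sup [set r | exists2 eta : probability (borel_seqsp R) R,
                 shift_invariant eta & r = \int[eta]_x A x].

Definition maximizing (A : seqsp R -> R)
    (mu : probability (borel_seqsp R) R) : Prop :=
  shift_invariant mu /\ \int[mu]_x A x = max_integral A.

End definitions.

(* Main.v *)
Require Import Defs.
From HB Require Import structures.
From mathcomp Require Import all_boot all_order all_algebra.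
From mathcomp Require Import all_classical all_reals all_analysis.
From mathcomp Require Import measurable_realfun ring lra.

Set Implicit Arguments.
Unset Strict Implicit.
Unset Printing Implicit Defensive.

Import Order.TTheory GRing.Theory Num.Theory.
Import numFieldNormedType.Exports.
(* [Defs.shift] would otherwise be hidden by the translation [shift] of the
   library. *)
Import Defs.

Local Open Scope classical_set_scope.
Local Open Scope ring_scope.

(* Write lambda, psi for the eigenpair of beta A.
   Upper bound on lambda: mu_beta is fixed by the dual of the normalized
   operator L, and L(Bbar) >= 0 pointwise by t e^t >= e^t - 1 together with
   L(1) = 1; hence 0 <= int Bbar dmu_beta, that is
   ln lambda <= beta int A dmu_beta (the entropy is nonpositive).
   Lower bound on lambda: bootstrapping the eigenvalue equation, ln psi is
   Hoelder with a constant at most beta times one depending only on A.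
   Keeping in L_{beta A} psi (shift z) only the letters a with
   |atan a - atan z_0| < delta, whose f-mass is at least some m > 0 uniformly in
   z_0, gives beta A(z) + ln psi(z) + ln m - beta e <= ln lambda + ln psi(shift z).
   Integrating against an invariant eta yields
   int A deta <= int A dmu_beta + e - ln m / beta, and beta -> +oo concludes. *)

(** * The metric on sequences and Hölder functions *)

Section sequence_space.
Context {R : realType}.
Implicit Types x y : seqsp R.

(** Two values of arctan differ by less than pi, so the series is dominated by the geometric series
    with terms 1/2, 1/4, ..., of sum 1. *)
Lemma mdist_le1 x y : mdist x y <= 1.
Proof.
have half1 : `|2^-1 : R| < 1 by rewrite ger0_norm ?invr_ge0// invf_lt1 ?ltr1n.
have <- : limn (series (geometric (2^-1 : R) 2^-1)) = 1.
  rewrite (cvg_lim _ (cvg_geometric_series half1))//.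
  by rewrite [X in _ / X](_ : _ = 2^-1) ?divff//; lra.
apply: lim_series_le; first exact: is_cvg_sdist.
- exact: is_cvg_geometric_series.
- exact: sdist_term_le.
Qed.

(** Once the first term is split off, each remaining weight is half the corresponding weight for the
    shifted sequences. Continuity of the shift and the halving of distances under a common prepended
    letter both follow. *)
Lemma mdist_shift x y : mdist x y =
  (pi * 2)^-1 * `|atan (x 0%N) - atan (y 0%N)| + mdist (shift x) (shift y) / 2.
Proof.
rewrite /mdist/= /sdist; apply/cvg_lim => //.
rewrite -(cvg_shiftS (series (sdist_term x y))).
rewrite (_ : (fun n => _) = fun n => sdist_term x y 0 +
    series (sdist_term (shift x) (shift y)) n / 2); last first.
  apply/funext => n; rewrite /series/= big_nat_recl//= mulr_suml.
  congr (_ + _); apply: eq_bigr => i _.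
  by rewrite /sdist_term mulrAC exprS mulrCA invfM [2^-1 * _]mulrC.
apply: cvgD; first by rewrite /sdist_term expr1; exact: cvg_cst.
by apply: cvgMl; exact: is_cvg_sdist.
Qed.

Lemma mdist_scons_tail (a : R) x y : mdist (scons a x) (scons a y) = mdist x y / 2.
Proof. by rewrite mdist_shift/= subrr normr0 mulr0 add0r. Qed.

Lemma mdist_scons_head (a b : R) x :
  mdist (scons a x) (scons b x) = (pi * 2)^-1 * `|atan a - atan b|.
Proof.
by rewrite mdist_shift/= [shift (scons b x)](_ : _ = shift (scons a x))//
  mdistxx mul0r addr0.
Qed.

Lemma continuous_mdistP (T : topologicalType) (g : T -> seqsp R) :
  (forall t e, 0 < e -> \forall t' \near t, mdist (g t) (g t') < e) ->
  continuous g.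
Proof.
move=> h t; apply/cvg_ballP => e e0.
by near do rewrite ballEmdist/=; exact: h.
Unshelve. all: by end_near. Qed.

Lemma continuous_shift : continuous (@shift R).
Proof.
apply: continuous_mdistP => x e e0.
apply: filterS (nbhsx_ballx x (e / 2) _) => [y|]; last by rewrite divr_gt0.
rewrite ballEmdist/= ltr_pdivlMr// (mdist_shift x y); apply: le_lt_trans.
rewrite mulrDl divfK ?lerDr ?mulr_ge0 ?invr_ge0 ?mulr_ge0 ?pi_ge0 //.
Qed.

Lemma continuous_scons x : continuous (fun a => scons a x).
Proof.
apply: continuous_mdistP => a e e0.
have e1 : 0 < e * (pi * 2) by rewrite !mulr_gt0// pi_gt0.
have /cvgrPdist_lt/(_ _ e1) := @continuous_atan R a.
apply: filterS => b ab.
by rewrite mdist_scons_head mulrC ltr_pdivrMr// mulr_gt0// pi_gt0.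
Qed.

Section hoelder.
Variables (alpha : R) (alpha_gt0 : 0 < alpha).

Lemma hoelder_fun_gt0 (phi : seqsp R -> R) : hoelder_fun alpha phi ->
  exists2 C, 0 < C & forall x y, `|phi x - phi y| <= C * mdist x y `^ alpha.
Proof.
move=> [C hC]; exists (`|C| + 1); first by rewrite ltr_wpDl.
move=> x y; apply: (le_trans (hC x y)); rewrite ler_wpM2r ?powR_ge0//.
by rewrite (le_trans (ler_norm C))// lerDl.
Qed.

Lemma hoelder_continuous (phi : seqsp R -> R) :
  hoelder_fun alpha phi -> continuous phi.
Proof.
move=> /hoelder_fun_gt0[C C0 hC] x; apply/(@cvgrPdist_lt _ _ _ (nbhs x)) => e e0.
have eC0 : 0 < e / C by rewrite divr_gt0.
(* The radius r solves C r^alpha = e. *)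
apply/nbhs_ballP; exists ((e / C) `^ alpha^-1); first exact: powR_gt0.
move=> y; rewrite ballEmdist/= => xy; apply: (le_lt_trans (hC x y)).
rewrite mulrC -ltr_pdivlMr//.
rewrite -[ltRHS]powRr1 ?ltW// -(@mulVf _ alpha) ?gt_eqF// powRrM.
by apply: gt0_ltr_powR; rewrite ?nnegrE ?powR_ge0 ?mdist_ge0.
Qed.

Lemma hoelder_bounded_continuous (phi : seqsp R -> R) :
  hoelder_fun alpha phi -> bounded_continuous phi.
Proof.
move=> hphi; split; first exact: hoelder_continuous.
have [C C0 hC] := hoelder_fun_gt0 hphi.
exists (C + `|phi point|) => x; rewrite -[phi x](subrK (phi point)).
apply: (le_trans (ler_normD _ _)); rewrite lerD2r (le_trans (hC _ _))//.
rewrite ger_pMr// [leRHS](_ : 1 = 1 `^ alpha); last by rewrite powR1.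
by apply: ge0_ler_powR; rewrite ?nnegrE ?mdist_ge0 ?ler01 ?mdist_le1
  ?(ltW alpha_gt0).
Qed.

End hoelder.
End sequence_space.

(** * Integrals against finite measures and image measures *)

Lemma Rintegral_probability_cst d (T : measurableType d) (R : realType)
  (mu : probability T R) (r : R) : \int[mu]_x r = r.
Proof. by rewrite Rintegral_cst// [X in fine X]probability_setT mulr1. Qed.

Lemma cvg_Rintegral_indic d (T : measurableType d) (R : realType)
    (m : {measure set T -> \bar R}) (phi_ : nat -> T -> R) (U : set T) :
  (m setT < +oo)%E -> measurable U ->
  (forall n, measurable_fun setT (phi_ n)) ->
  (forall n x, 0 <= phi_ n x <= 1) ->
  (forall x, phi_ n x @[n --> \oo] --> (\1_U x : R)) ->
  \int[m]_x phi_ n x @[n --> \oo] --> fine (m U).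
Proof.
move=> moo mU mphi bphi cphi.
have mUoo : (m U < +oo)%E.
  by apply: le_lt_trans moo; apply: le_measure => //; rewrite inE.
have icst : m.-integrable setT (EFin \o cst 1).
  apply: measurable_bounded_integrable => //.
  by exists 1; split => // x x1 y _; rewrite /= normr1 ltW.
have key : (\int[m]_x (phi_ n x)%:E @[n --> \oo] --> \int[m]_x (\1_U x)%:E)%E.
  have [|||||_ _] := @dominated_convergence _ _ _ m _ measurableT
    (fun n => EFin \o phi_ n) (EFin \o \1_U) (EFin \o cst 1).
  - by move=> n; apply/measurable_EFinP.
  - by apply/measurable_EFinP.
  - by apply: aeW => x _; apply: cvg_EFin; [exact: nearW|exact: cphi].
  - by [].
  - apply: aeW => x n _ /=; rewrite lee_fin.
    by have /andP[phi0 phi1] := bphi n x; rewrite ger0_norm.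
  - by [].
move: key; rewrite integral_indic// setIT -[m U]fineK ?ge0_fin_numE//.
by move=> /fine_cvgP[].
Qed.

(** Used in two cases: [n] equal to an invariant measure [m], and [n] the pushforward of [m] by the
    shift. *)
Lemma Rintegral_image_measure d1 d2 (T1 : measurableType d1)
    (T2 : measurableType d2) (R : realType) (m : {measure set T1 -> \bar R})
    (n : {measure set T2 -> \bar R}) (g : T1 -> T2) (phi : T2 -> R) :
  measurable_fun setT g -> (forall U, measurable U -> m (g @^-1` U) = n U) ->
  measurable_fun setT phi -> m.-integrable setT (EFin \o (phi \o g)) ->
  \int[m]_x phi (g x) = \int[n]_x phi x.
Proof.
move=> mg mn mphi iphi; rewrite /Rintegral; congr fine.
rewrite -(@integral_pushforward _ _ _ _ _ _ mg m setT (EFin \o phi))//=.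
  by apply: eq_measure_integral => U mU _; exact: mn.
exact/measurable_EFinP.
Qed.

(** * Borel measures, invariance and weak limits *)

Section borel_measures.
Context {R : realType}.
Implicit Types (phi : seqsp R -> R) (mu eta : probability (borel_seqsp R) R).

Lemma open_measurable_seqsp (U : set (seqsp R)) :
  open U -> measurable (U : set (borel_seqsp R)).
Proof. by move=> oU; exact: sub_sigma_algebra. Qed.

Lemma continuous_measurable_seqsp phi :
  continuous phi -> measurable_fun [set: borel_seqsp R] phi.
Proof.
move=> /continuousP cphi; apply: (measurability _ (RGenOpens.measurableE R)).
move=> _ [_ [a [b ->] <-]]; rewrite setTI.
by apply: open_measurable_seqsp; apply: cphi; exact: interval_open.
Qed.

Lemma measurable_shift :
  measurable_fun [set: borel_seqsp R] (@shift R : borel_seqsp R -> borel_seqsp R).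
Proof.
apply: (@measurability _ _ (borel_seqsp R) (borel_seqsp R) _ _
  (@open (seqsp R))) => //.
move=> _ [U oU <-]; rewrite setTI; apply: open_measurable_seqsp.
by move/continuousP : (@continuous_shift R); exact.
Qed.

Lemma bounded_continuous_integrable mu phi : bounded_continuous phi ->
  mu.-integrable [set: borel_seqsp R] (EFin \o phi).
Proof.
move=> [cphi [M bM]]; apply: measurable_bounded_integrable => //.
- exact: le_lt_trans (probability_le1 mu measurableT) (ltry _).
- exact: continuous_measurable_seqsp.
- exists M; split; first exact: num_real.
  by move=> x Mx y _; exact: le_trans (bM y) (ltW Mx).
Qed.

Lemma bounded_continuous_comp_shift phi :
  bounded_continuous phi -> bounded_continuous (phi \o @shift R).
Proof.
move=> [cphi [M bM]]; split; last by exists M => x; exact: bM.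
by move=> x; apply: continuous_comp; [exact: continuous_shift|exact: cphi].
Qed.

Lemma bounded_continuous_cst (r : R) : bounded_continuous (fun=> r).
Proof.
split; first by move=> x; apply: cst_continuous.
by exists `|r|.
Qed.

Lemma bounded_continuousD phi psi : bounded_continuous phi ->
  bounded_continuous psi -> bounded_continuous (fun x => phi x + psi x).
Proof.
move=> [cphi [M bM]] [cpsi [N bN]]; split.
  by move=> x; exact: (cvgD (cphi x) (cpsi x)).
by exists (M + N) => x; apply: (le_trans (ler_normD _ _)); rewrite lerD.
Qed.

Lemma bounded_continuousN phi :
  bounded_continuous phi -> bounded_continuous (fun x => - phi x).
Proof.
move=> [cphi [M bM]]; split; first by move=> x; exact: (cvgN (cphi x)).
by exists M => x; rewrite normrN.
Qed.

Lemma bounded_continuousZ (r : R) phi :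
  bounded_continuous phi -> bounded_continuous (fun x => r * phi x).
Proof.
move=> [cphi [M bM]]; split; first by move=> x; exact: (cvgMr (cphi x)).
by exists (`|r| * M) => x; rewrite normrM ler_wpM2l.
Qed.

Lemma shift_invariant_Rintegral eta phi : shift_invariant eta ->
  bounded_continuous phi -> \int[eta]_x phi (shift x) = \int[eta]_x phi x.
Proof.
move=> inv bc; apply: Rintegral_image_measure => //.
- exact: measurable_shift.
- by apply: continuous_measurable_seqsp; case: bc.
- exact/bounded_continuous_integrable/bounded_continuous_comp_shift.
Qed.

(** Urysohn functions are taken between the complement of U and the set [B n] of points whose ball
    of radius 1/(n+1) lies in U. They vanish off U, and each point of U belongs to [B n] for all
    large n. *)
Lemma open_indic_approx (U : set (seqsp R)) : open U ->
  exists phi_ : nat -> seqsp R -> R,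
    [/\ forall n, continuous (phi_ n), forall n x, 0 <= phi_ n x <= 1
      & forall x, phi_ n x @[n --> \oo] --> (\1_U x : R)].
Proof.
move=> oU; pose B n := [set x : seqsp R | ball x n.+1%:R^-1 `<=` U].
have sep n : uniform_separator (~` U) (B n).
  apply: uniform_separatorW.
  exists [set xy : seqsp R * seqsp R | ball xy.1 n.+1%:R^-1 xy.2].
    by apply: entourage_ball (PosNum _); rewrite invr_gt0.
  rewrite -subset0 => -[x y] [[/= Ux BUy] xy].
  by apply: Ux; apply: BUy; exact: ball_sym.
exists (fun n => @Urysohn _ R (~` U) (B n)); split.
- by move=> n; exact: Urysohn_continuous.
- move=> n x; have := @Urysohn_range _ R (~` U) (B n) (Urysohn (~` U) (B n) x).
  by rewrite /= in_itv/=; apply; exists x.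
- move=> x; rewrite indicE; have [xU|xU] := boolP (x \in U); last first.
    apply: cvg_near_cst; near=> n.
    apply: (@Urysohn_sub0 _ R _ _ (sep n)); exists x => //.
    by rewrite /setC/= => Ux; rewrite mem_set in xU.
  have [e /= e0 xeU] : exists2 e : R, 0 < e & ball x e `<=` U.
    by apply/nbhs_ballP; apply: open_nbhs_nbhs; split => //; exact: set_mem.
  apply: cvg_near_cst; near=> n.
  apply: (@Urysohn_sub1 _ R _ _ (sep n)); exists x => //.
  apply: subset_trans xeU; apply: le_ball; apply: ltW.
  by near: n; exact: near_infty_natSinv_lt (PosNum e0).
Unshelve. all: by end_near. Qed.

(** Open sets are stable under intersection and generate the Borel sets, so agreement on them
    suffices. There both measures are limits of integrals of the same continuous functions with
    values in [0, 1]. *)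
Lemma eq_measure_bounded_continuous
    (mu nu : {measure set (borel_seqsp R) -> \bar R}) :
  (mu setT < +oo)%E -> (nu setT < +oo)%E ->
  (forall phi, bounded_continuous phi -> \int[mu]_x phi x = \int[nu]_x phi x) ->
  forall U, measurable U -> mu U = nu U.
Proof.
move=> muoo nuoo eq_int.
apply: (@measure_unique _ _ (borel_seqsp R) (@open (seqsp R)) (fun=> setT)).
- by [].
- by move=> A B; exact: openI.
- by move=> _; exact: openT.
- by rewrite bigcup_const//; exists 0%N.
- move=> U oU.
  have [phi_ [cphi bphi phiU]] := open_indic_approx oU.
  have key (m : {measure set (borel_seqsp R) -> \bar R}) : (m setT < +oo)%E ->
      \int[m]_x phi_ n x @[n --> \oo] --> fine (m U).
    move=> moo; apply: cvg_Rintegral_indic => //; first exact: open_measurable_seqsp.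
    by move=> n; exact: continuous_measurable_seqsp.
  have fin (m : {measure set (borel_seqsp R) -> \bar R}) :
      (m setT < +oo)%E -> m U \is a fin_num.
    move=> moo; rewrite ge0_fin_numE//; apply: le_lt_trans moo.
    by apply: le_measure; rewrite ?inE//; exact: open_measurable_seqsp.
  rewrite -(fineK (fin _ muoo)) -(fineK (fin _ nuoo)); congr EFin.
  apply: (cvg_unique _ (key _ muoo)) => //.
  rewrite (_ : (fun n => _) = fun n => \int[nu]_x phi_ n x); first exact: key.
  apply/funext => n; apply: eq_int; split => //; exists 1 => x.
  by have /andP[phi0 phi1] := bphi n x; rewrite ger0_norm.
- by move=> _.
Qed.

(** Both phi and its composition with the shift are admissible test functions, and their integrals
    agree along the sequence. In the limit, mu and its pushforward [nu] integrate every test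
    function alike. *)
Lemma weak_limit_shift_invariant (mu_ : nat -> probability (borel_seqsp R) R) mu :
  (forall n, shift_invariant (mu_ n)) -> weak_cvg mu_ mu -> shift_invariant mu.
Proof.
move=> inv cv.
pose pushed : {measure set (borel_seqsp R) -> \bar R} :=
  pushforward mu (@shift R : borel_seqsp R -> borel_seqsp R).
pose nu := pushed measurable_shift.
suff eq_int phi : bounded_continuous phi -> \int[nu]_x phi x = \int[mu]_x phi x.
  move=> U mU; have muoo : (mu setT < +oo)%E.
    exact: le_lt_trans (probability_le1 mu measurableT) (ltry _).
  exact: (@eq_measure_bounded_continuous nu mu muoo muoo eq_int U mU).
move=> bc; transitivity (\int[mu]_x phi (shift x)).
  apply/esym/Rintegral_image_measure => //; first exact: measurable_shift.
  - by apply: continuous_measurable_seqsp; case: bc.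
  - exact/bounded_continuous_integrable/bounded_continuous_comp_shift.
apply: (cvg_unique _ (cv _ (bounded_continuous_comp_shift bc))) => //.
rewrite (_ : (fun n => _) = fun n => \int[mu_ n]_x phi x); first exact: cv.
by apply/funext => n; exact: shift_invariant_Rintegral.
Qed.

End borel_measures.

(** * Mass given by the prior density to arctan neighbourhoods *)

Section prior.
Context {R : realType}.
Local Notation leb := (@lebesgue_measure R).
Variables (f : R -> R) (f_gt0 : forall a, 0 < f a) (f_cont : continuous f).
Hypothesis f_int1 : (\int[leb]_a (f a)%:E = 1)%E.

Let f_integrable : leb.-integrable setT (EFin \o f).
Proof.
apply/integrableP; split.
  by apply/measurable_EFinP; exact: continuous_measurable_fun.
under eq_integral do rewrite /= ger0_norm ?ltW//.
by rewrite f_int1 ltry.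
Qed.

Lemma integrable_mul_prior (g : R -> R) : measurable_fun setT g ->
  (exists M, forall a, `|g a| <= M) ->
  leb.-integrable setT (EFin \o (fun a => g a * f a)).
Proof.
move=> mg [M gM]; apply: (@le_integrable _ _ _ leb setT measurableT _
  (fun a => M%:E * (EFin \o f) a)%E); last exact: integrableZl.
  apply/measurable_EFinP; apply: measurable_funM => //.
  exact: continuous_measurable_fun.
move=> a _ /=; rewrite lee_fin normrM (le_trans _ (ler_norm _))//.
by rewrite (ger0_norm (ltW (f_gt0 a))) ler_wpM2r// ltW.
Qed.

Lemma Rintegral_prior : \int[leb]_a f a = 1.
Proof. by rewrite /Rintegral f_int1. Qed.

Lemma atan_lipschitz (a b : R) : `|atan a - atan b| <= `|a - b|.
Proof.
wlog ab : a b / a < b => [hw|].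
  have [/hw//|/hw|->] := ltgtP a b; last by rewrite !subrr.
  by rewrite distrC [leRHS]distrC.
have catan : {within `[a, b], continuous (@atan R)}.
  by apply: derivable_within_continuous => z _; exact: derivable_atan.
have [c _ atanE] := MVT ab (fun z _ => is_derive1_atan z) catan.
rewrite distrC atanE [leRHS]distrC normrM ger_pMl ?normr_gt0 ?subr_eq0 ?gt_eqF//.
have c1 : 1 <= 1 + c ^+ 2 by rewrite lerDl sqr_ge0.
have c0 : 0 < 1 + c ^+ 2 by exact: lt_le_trans c1.
by rewrite ger0_norm ?invf_le1// invr_ge0 ltW.
Qed.

(** Since arctan converges at both infinities, every far point is arctan-close to an endpoint T or
    -T. This replaces compactness of the alphabet: estimates uniform in t reduce to a bounded
    interval. *)
Lemma clamp_atan (delta : R) : 0 < delta -> exists2 T, 0 < T &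
  forall t, exists2 s, - T <= s <= T & `|atan s - atan t| < delta.
Proof.
move=> delta0.
have [T T0 aT] : exists2 T : R, 0 < T & pi / 2 - delta < atan T.
  near (pinfty_nbhs R) => T; exists T; first by near: T; exact: nbhs_pinfty_gt.
  rewrite ltrBlDl -ltrBlDr (le_lt_trans (ler_norm _))//; near: T.
  by move/cvgrPdist_lt : (@cvgy_atan R); exact.
exists T => // t; have [tT|Tt] := leP t T; last first.
  exists T; first by rewrite lexx andbT; lra.
  have := lt_atan Tt; have := atan_ltpi2 t.
  by move=> ? ?; rewrite ltr_distlC; apply/andP; split; lra.
have [Tt|tT'] := leP (- T) t.
  by exists t; [exact/andP|rewrite subrr normr0].
exists (- T); first by rewrite lexx/=; lra.
have := lt_atan tT'; have := atan_gtNpi2 t; rewrite atanN.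
by move=> ? ?; rewrite ltr_distlC; apply/andP; split; lra.
Unshelve. all: by end_near. Qed.

(* [m] is a lower bound for the [f]-mass of the sets [|atan a - atan t| < delta],
   in the integrated form in which it is used. *)
Definition prior_mass_bound (delta m : R) : Prop :=
  forall t c (g : R -> R), 0 <= c -> measurable_fun setT g ->
    (exists M, forall a, `|g a| <= M) -> (forall a, 0 <= g a) ->
    (forall a, `|atan a - atan t| < delta -> c <= g a) ->
    c * m <= \int[leb]_a (g a * f a).

Lemma prior_mass_gt0 (delta : R) : 0 < delta ->
  exists2 m, 0 < m & prior_mass_bound delta m.
Proof.
move=> delta0; have delta2 : 0 < delta / 2 by rewrite divr_gt0.
have [T T0 clampT] := clamp_atan delta2.
have [p _ fp] : exists2 p, p \in `[- T - delta, T + delta] &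
    forall t, t \in `[- T - delta, T + delta] -> f p <= f t.
  apply: EVT_min; first lra.
  by apply: continuous_subspaceT.
(* Minimum of f on a compact interval times the length of [I]. The interval [I] of radius delta/2
   about the clamped point s stays within arctan-distance delta of t because arctan is
   1-Lipschitz. *)
exists (f p * delta); first by rewrite mulr_gt0.
move=> t c g c0 mg bg g0 cg; have [s sT st] := clampT t.
pose I := `]s - delta / 2, s + delta / 2[%classic.
have mI : measurable (I : set R) by exact: measurable_itv.
have lebI : leb I = delta%:E.
  by rewrite lebesgue_measure_itv/= lte_fin ifT -?EFinB; [congr EFin|]; lra.
have Ioo : (leb I < +oo)%E by rewrite lebI ltry.
have ig := integrable_mul_prior mg bg.
have -> : c * (f p * delta) = \int[leb]_(a in I) (c * f p).
  by rewrite Rintegral_cst// [X in fine X]lebI mulrA.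
apply: (@le_trans _ _ (\int[leb]_(a in I) (g a * f a))).
  apply: le_Rintegral => //.
  - apply: measurable_bounded_integrable => //.
    by exists `|c * f p|; split => // x cx a _; rewrite ltW.
  - exact: integrableS ig.
  move=> a; rewrite /I/= in_itv/= => /andP[a1 a2].
  apply: ler_pM => //; first exact: ltW.
    apply: cg; rewrite (_ : _ - _ = (atan a - atan s) + (atan s - atan t)); last lra.
    rewrite (le_lt_trans (ler_normD _ _))// [ltRHS]splitr ltrD//.
    rewrite (le_lt_trans (atan_lipschitz _ _))// ltr_distlC.
    by apply/andP; split; lra.
  by apply: fp; rewrite in_itv/=; apply/andP; split; lra.
apply: fine_le; [exact: integrable_fin_num (integrableS _ _ _ ig)|
                 exact: integrable_fin_num ig|].
apply: ge0_subset_integral => //; first by case/integrableP: ig.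
by move=> a _; rewrite lee_fin mulr_ge0// ltW.
Qed.

End prior.

(** * Integrability and monotonicity of the Ruelle operator *)

Section ruelle_operator.
Context {R : realType}.
Local Notation leb := (@lebesgue_measure R).
Variables (alpha : R) (alpha_gt0 : 0 < alpha).
Variables (f : R -> R) (f_gt0 : forall a, 0 < f a) (f_cont : continuous f).
Hypothesis f_int1 : (\int[leb]_a (f a)%:E = 1)%E.
Implicit Types (B phi psi : seqsp R -> R) (x y z : seqsp R).

Definition ruelle_weight B phi x (a : R) : R :=
  expR (B (scons a x)) * phi (scons a x).

Lemma measurable_ruelle_weight B phi x : continuous B -> continuous phi ->
  measurable_fun setT (ruelle_weight B phi x).
Proof.
move=> cB cphi; apply: continuous_measurable_fun => a.
have cs := @continuous_scons R x a.
have c1 : {for a, continuous (fun a => expR (B (scons a x)))}.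
  apply: (@continuous_comp _ _ _ (fun a => B (scons a x)) expR).
    exact: (continuous_comp cs (cB _)).
  exact: continuous_expR.
have c2 : {for a, continuous (fun a => phi (scons a x))}.
  exact: (continuous_comp cs (cphi _)).
exact: (cvgM c1 c2).
Qed.

Lemma bounded_ruelle_weight B phi x : bounded_continuous B ->
  bounded_continuous phi -> exists M, forall a, `|ruelle_weight B phi x a| <= M.
Proof.
move=> [_ [M bM]] [_ [N bN]]; exists (expR M * N) => a.
rewrite /ruelle_weight normrM ler_pM// ger0_norm ?expR_ge0// ler_expR.
by rewrite (le_trans (ler_norm _)).
Qed.

Lemma ruelle_integrable B phi x : bounded_continuous B ->
  bounded_continuous phi ->
  leb.-integrable setT (EFin \o (fun a => ruelle_weight B phi x a * f a)).
Proof.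
move=> bcB bcphi; apply: integrable_mul_prior => //.
- by case: bcB => cB _; case: bcphi => cphi _; exact: measurable_ruelle_weight.
- exact: bounded_ruelle_weight.
Qed.

(** The two base points and the factor k allow the ratio psi x / psi y to be bounded through the
    eigenvalue equation. *)
Lemma le_ruelle B phi B' phi' (k : R) x y :
  bounded_continuous B -> bounded_continuous phi ->
  bounded_continuous B' -> bounded_continuous phi' ->
  (forall a, ruelle_weight B phi x a <= k * ruelle_weight B' phi' y a) ->
  ruelle f B phi x <= k * ruelle f B' phi' y.
Proof.
move=> bB bphi bB' bphi' h; rewrite /ruelle.
have i' := ruelle_integrable y bB' bphi'.
rewrite -RintegralZl//; apply: le_Rintegral => //.
- exact: ruelle_integrable.
- exact: (integrableZl measurableT k i').
- by move=> a _; rewrite mulrA; apply: ler_wpM2r; [exact: ltW|exact: h].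
Qed.

(** * Regularity of the eigenfunction and bounds on the eigenvalue *)

Section eigenfunction.
Variables (B psi : seqsp R -> R) (lambda : R).
Hypotheses (lambda_gt0 : 0 < lambda) (psi_gt0 : forall x, 0 < psi x).
Hypothesis eigen : forall x, ruelle f B psi x = lambda * psi x.
Hypotheses (bcB : bounded_continuous B) (bcpsi : bounded_continuous psi).

(** The integrand in the eigenvalue equation is nonnegative, so letters far from t can be
    discarded. *)
Lemma eigenfunction_mass delta m x t c : prior_mass_bound f delta m -> 0 <= c ->
  (forall a, `|atan a - atan t| < delta -> c <= ruelle_weight B psi x a) ->
  c * m <= lambda * psi x.
Proof.
move=> hm c0 hc; rewrite -eigen; apply: hm hc => //.
- by case: bcB => cB _; case: bcpsi => cpsi _; exact: measurable_ruelle_weight.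
- exact: bounded_ruelle_weight.
- by move=> a; rewrite mulr_ge0 ?expR_ge0// ltW.
Qed.

(* Prepending a coordinate close to 0 contracts the distance to the zero
   sequence, so a lower bound on a ball propagates to a ball larger by the
   factor 4/3, and finally to the whole space. *)
Lemma eigenfunction_lower_bound : exists2 c, 0 < c & forall x, c <= psi x.
Proof.
pose o : seqsp R := fun=> 0.
have so : scons 0 o = o by apply/funext => -[].
have [cpsi _] := bcpsi; have [_ [M bM]] := bcB.
have [r0 r00 hr0] : exists2 r, 0 < r &
    forall x, mdist o x < r -> psi o / 2 <= psi x.
  have : \forall x \near o, `|psi o - psi x| < psi o / 2.
    by move/cvgrPdist_lt : (cpsi o); apply; rewrite divr_gt0.
  move=> /nbhs_ballP[r /= r0 hr]; exists r => // x ox.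
  have /ltr_normlP[_ ] : `|psi o - psi x| < psi o / 2 by apply: hr; rewrite ballEmdist.
  lra.
have step r : 0 < r ->
    (exists2 c, 0 < c & forall x, mdist o x < r -> c <= psi x) ->
    exists2 c, 0 < c & forall x, mdist o x < r * (4 / 3) -> c <= psi x.
  move=> r_gt0 [c c0 hc].
  (* With this delta, a letter near 0 costs less than r/3. The tail costs less than half of 4r/3, so
     the prepended sequence lies within r of [o]. *)
  have delta0 : 0 < pi * 2 * (r / 3) by rewrite !mulr_gt0// pi_gt0.
  have [m m0 hm] := prior_mass_gt0 f_gt0 f_cont f_int1 delta0.
  exists (expR (- M) * c * m / lambda).
    by rewrite divr_gt0// !mulr_gt0// expR_gt0.
  move=> x ox; rewrite ler_pdivrMr// mulrC [psi x * _]mulrC mulrC.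
  apply: (eigenfunction_mass (t := 0) hm) => [|a ha].
    by rewrite mulr_ge0 ?expR_ge0// ltW.
  rewrite ler_pM ?expR_ge0 ?(ltW c0)//.
    by rewrite ler_expR lerNl (le_trans _ (bM (scons a x)))// -normrN ler_norm.
  apply: hc; rewrite -{1}so (le_lt_trans (metric_triangle _ (scons 0 x) _))//.
  rewrite mdist_scons_tail mdist_scons_head distrC.
  have : (pi * 2)^-1 * `|atan a - atan 0| < r / 3.
    by rewrite mulrC ltr_pdivrMr 1?mulrC// mulr_gt0// pi_gt0.
  lra.
have all n : exists2 c, 0 < c &
    forall x, mdist o x < r0 * (4 / 3) ^+ n -> c <= psi x.
  elim: n => [|n ih].
    by exists (psi o / 2); [rewrite divr_gt0|move=> x; rewrite mulr1; exact: hr0].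
  rewrite exprSr (mulrA r0); apply: step => //.
  by rewrite mulr_gt0// exprn_gt0//; lra.
(* All distances are at most 1, so a ball of radius greater than 1 is the whole space. *)
have [n hn] : exists n, 1 < r0 * (4 / 3) ^+ n.
  have : (3 / 4 : R) ^+ n @[n --> \oo] --> 0 by apply: cvg_expr; rewrite ger0_norm; lra.
  move/cvgrPdist_lt => /(_ _ r00)[n _ /(_ n (leqnn n))].
  rewrite sub0r normrN ger0_norm ?exprn_ge0 ?divr_ge0// => hn; exists n.
  by rewrite -ltr_pdivrMr ?exprn_gt0 ?divr_gt0// div1r -exprVn invf_div.
have [c c0 hc] := all n; exists c => // x; apply: hc.
exact: le_lt_trans (mdist_le1 _ _) hn.
Qed.

(** Pointwise positivity of psi does not bound ln psi below; the uniform lower bound does. *)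
Lemma bounded_continuous_ln_eigenfunction :
  bounded_continuous (fun x => ln (psi x)).
Proof.
have [c c0 hc] := eigenfunction_lower_bound; have [cpsi [N bN]] := bcpsi.
split.
  by move=> x; exact: (continuous_comp (cpsi x) (continuous_ln (psi_gt0 x))).
exists (`|ln c| + `|ln N|) => x.
have psiN : psi x <= N by rewrite (le_trans (ler_norm _)).
have N0 : 0 < N by exact: lt_le_trans psiN.
have lnc : ln c <= ln (psi x) by rewrite ler_ln ?posrE.
have lnN : ln (psi x) <= ln N by rewrite ler_ln ?posrE.
have := ler_norm (- ln c); have := ler_norm (ln N); rewrite normrN.
have := normr_ge0 (ln c); have := normr_ge0 (ln N).
by move=> *; rewrite ler_norml; apply/andP; split; lra.
Qed.

Definition contraction : R := 2^-1 `^ alpha.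

Lemma contraction_gt0 : 0 < contraction.
Proof. by rewrite powR_gt0// invr_gt0. Qed.

Lemma contraction_lt1 : contraction < 1.
Proof.
rewrite [ltRHS](_ : 1 = 1 `^ alpha); last by rewrite powR1.
by apply: gt0_ltr_powR; rewrite ?nnegrE ?invr_ge0 ?ler01// invf_lt1// ltr1n.
Qed.

Lemma mdist_scons_powR (a : R) x y :
  mdist (scons a x) (scons a y) `^ alpha = contraction * mdist x y `^ alpha.
Proof. by rewrite mdist_scons_tail powRM ?mdist_ge0 ?invr_ge0// mulrC. Qed.

Section hoelder_potential.
Variables (C : R) (C_ge0 : 0 <= C).
Hypothesis hB : forall x y, `|B x - B y| <= C * mdist x y `^ alpha.

(** Prepending a letter contracts the distance, so the integrands at x and y have ratio at most the
    exponential of the claimed bound. Integrating and cancelling lambda transfers this to psi. *)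
Let ln_eigenfunction_step (K : R) :
  (forall x y, ln (psi x) - ln (psi y) <= K * mdist x y `^ alpha) ->
  forall x y, ln (psi x) - ln (psi y) <=
              (C + K) * contraction * mdist x y `^ alpha.
Proof.
move=> hK x y; rewrite lerBlDr -ler_expR expRD !lnK ?posrE//.
rewrite -(ler_pM2l lambda_gt0) mulrCA -!eigen.
apply: le_ruelle => // a; rewrite /ruelle_weight.
have := hK (scons a x) (scons a y).
have := le_trans (ler_norm _) (hB (scons a x) (scons a y)).
rewrite mdist_scons_powR => h1 h2.
rewrite -[psi (scons a x)]lnK ?posrE// -[psi (scons a y)]lnK ?posrE//.
by rewrite -!expRD ler_expR; lra.
Qed.

(* Each application of the eigenvalue equation replaces the Hoelder constant
   [K] of [ln psi] by [(C + K) * contraction], whose fixed point is the bound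
   below; it is linear in [C], unlike the constant coming from [psi]. *)
Lemma ln_eigenfunction_hoelder : hoelder_fun alpha psi -> forall x y,
  ln (psi x) - ln (psi y) <=
  C * contraction / (1 - contraction) * mdist x y `^ alpha.
Proof.
move=> /hoelder_fun_gt0[C0 C00 hC0] x y.
have [c c0 hc] := eigenfunction_lower_bound.
have q0 := contraction_gt0; have q1 := contraction_lt1.
set q := contraction in q0 q1 *; set K := C * q / (1 - q).
have KE : (C + K) * q = K.
  have q1' : 1 - q != 0 by rewrite subr_eq0 gt_eqF.
  by rewrite /K; field.
(* The excess over the fixed point K shrinks by q at each step. The base case uses ln (1 + u) <= u
   with u = (psi x' - psi y') / psi y' and psi >= c, hence the initial excess [C0 / c]. *)
have bound n x' y' :
    ln (psi x') - ln (psi y') <= (q ^+ n * (C0 / c) + K) * mdist x' y' `^ alpha.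
  elim: n x' y' => [|n ih] x' y'; last first.
    rewrite (le_trans (ln_eigenfunction_step ih _ _))// -/q ler_wpM2r ?powR_ge0//.
    by rewrite exprS; lra.
  rewrite -ln_div ?posrE// [X in ln X](_ : _ = 1 + (psi x' - psi y') / psi y'); last first.
    by field; rewrite gt_eqF.
  have gtN1 : -1 < (psi x' - psi y') / psi y'.
    by rewrite ltr_pdivlMr// mulN1r ltrBrDl subrr.
  rewrite (le_trans (le_ln1Dx gtN1))// expr0 mul1r [leRHS]mulrDl ler_wpDr//.
    rewrite mulr_ge0 ?powR_ge0// /K mulr_ge0//; first by rewrite mulr_ge0// ltW.
    by rewrite invr_ge0; lra.
  rewrite ler_pdivrMr// (le_trans (ler_norm _))// (le_trans (hC0 _ _))//.
  rewrite -[C0 / c * _]mulrAC -[leRHS]mulrA [_^-1 * _]mulrC.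
  rewrite ler_peMr ?mulr_ge0 ?powR_ge0 ?(ltW C00)//.
  by rewrite ler_pdivlMr// mul1r.
apply/ler_addgt0Pr => e e0.
have : q ^+ n * (C0 / c * mdist x y `^ alpha) @[n --> \oo] --> 0.
  rewrite -[X in _ --> X](mul0r (C0 / c * mdist x y `^ alpha)); apply: cvgMl.
  by apply: cvg_expr; rewrite gtr0_norm.
move=> /cvgrPdist_lt/(_ _ e0)[n _ /(_ n (leqnn n))].
rewrite sub0r normrN => /ltW/(le_trans (ler_norm _)) hn.
by rewrite (le_trans (bound n _ _))//; lra.
Qed.

Lemma eigenvalue_ge (delta m : R) (eta : probability (borel_seqsp R) R) :
  hoelder_fun alpha psi -> shift_invariant eta ->
  0 < m -> prior_mass_bound f delta m ->
  \int[eta]_x B x + ln m -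
    C / (1 - contraction) * (delta / (pi * 2)) `^ alpha <= ln lambda.
Proof.
move=> hpsi inv m0 hm; set E := _ * _ `^ alpha.
have q0 := contraction_gt0; have q1 := contraction_lt1.
have bcV := bounded_continuous_ln_eigenfunction.
(* Replacing the first letter of z by one at arctan-distance less than delta lowers B + ln psi by at
   most E: the Hölder constants of B and ln psi add up to C / (1 - contraction). Under the integral
   the two ln psi terms cancel by invariance. *)
have pointwise z : B z + ln (psi z) + (ln m - E) <= ln lambda + ln (psi (shift z)).
  rewrite -lnM ?posrE// addrA addrAC -ler_expR expRD !lnK ?posrE ?mulr_gt0//.
  apply: (eigenfunction_mass (t := z 0%N) hm); first exact: expR_ge0.
  move=> a ha; rewrite /ruelle_weight -[psi (scons a _)]lnK ?posrE// -expRD ler_expR.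
  have zE : z = scons (z 0%N) (shift z) by apply/funext => -[].
  have dist : mdist z (scons a (shift z)) `^ alpha <= (delta / (pi * 2)) `^ alpha.
    rewrite {1}zE mdist_scons_head.
    apply: ge0_ler_powR; rewrite ?nnegrE ?(ltW alpha_gt0)//.
    - by rewrite mulr_ge0// invr_ge0 mulr_ge0// pi_ge0.
    - rewrite divr_ge0//; first exact: le_trans (ltW ha).
      by rewrite mulr_ge0// pi_ge0.
    - rewrite distrC mulrC ler_wpM2r ?invr_ge0 ?mulr_ge0 ?pi_ge0//.
      exact: ltW.
  have h1 := le_trans (ler_norm _) (hB z (scons a (shift z))).
  have h2 := ln_eigenfunction_hoelder hpsi z (scons a (shift z)).
  have h3 : (C + C * contraction / (1 - contraction)) *
      mdist z (scons a (shift z)) `^ alpha <= E.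
    rewrite (_ : C + _ = C / (1 - contraction)); last first.
      by field; rewrite subr_eq0 gt_eqF.
    by rewrite ler_wpM2l// divr_ge0// subr_ge0 ltW.
  lra.
have iB := bounded_continuous_integrable eta bcB.
have iV := bounded_continuous_integrable eta bcV.
have iVs := bounded_continuous_integrable eta (bounded_continuous_comp_shift bcV).
have icst r := bounded_continuous_integrable eta (bounded_continuous_cst r).
have : \int[eta]_x (B x + ln (psi x) + (ln m - E)) <=
       \int[eta]_x (ln lambda + ln (psi (shift x))).
  apply: le_Rintegral => //.
  - exact: (bounded_continuous_integrable eta (bounded_continuousD
      (bounded_continuousD bcB bcV) (bounded_continuous_cst _))).
  - exact: (bounded_continuous_integrable eta (bounded_continuousD
      (bounded_continuous_cst _) (bounded_continuous_comp_shift bcV))).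
rewrite !RintegralD//; last first.
  exact: (bounded_continuous_integrable eta (bounded_continuousD bcB bcV)).
rewrite !Rintegral_probability_cst (shift_invariant_Rintegral inv bcV).
lra.
Qed.

End hoelder_potential.

(** * The normalized potential and the upper bound on ln lambda *)

Local Notation Bn := (normalized_potential B lambda psi).

Let bounded_continuous_normalized : bounded_continuous Bn.
Proof.
have bcV := bounded_continuous_ln_eigenfunction.
apply: bounded_continuousD; last exact: bounded_continuous_cst.
apply: bounded_continuousD; first exact: bounded_continuousD.
exact/bounded_continuousN/(bounded_continuous_comp_shift bcV).
Qed.

(** Since shift (ax) = x, the factor 1 / (lambda psi x) leaves the integral, and what remains is the
    eigenvalue equation for psi. *)
Let ruelle_normalized1 x : ruelle f Bn (fun=> 1) x = 1.
Proof.
have lpsi0 : lambda * psi x != 0 by rewrite mulf_neq0 ?gt_eqF.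
rewrite -[RHS](mulVf lpsi0) -[X in _ = _ * X]eigen /ruelle.
rewrite -RintegralZl//; last exact: ruelle_integrable.
apply: eq_Rintegral => a _; rewrite mulr1 mulrA; congr (_ * _).
rewrite /normalized_potential (_ : shift (scons a x) = x)//.
rewrite !expRD !expRN !lnK ?posrE//.
by field; rewrite !gt_eqF.
Qed.

(* [t * expR t >= expR t - 1] applied to the normalized potential: relative
   entropy with respect to the prior [f] is nonnegative. *)
Let ruelle_normalized_ge0 x : 0 <= ruelle f Bn Bn x.
Proof.
have bcn := bounded_continuous_normalized.
have bc1 := @bounded_continuous_cst R 1.
have if1 : leb.-integrable setT (EFin \o f).
  rewrite (_ : EFin \o f = EFin \o (fun a => 1 * f a)).
    by apply: integrable_mul_prior => //; exists 1 => a; rewrite normr1.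
  by apply/funext => a /=; rewrite mul1r.
have i1 := ruelle_integrable x bcn bc1.
(* Writing 0 as L(1) minus the mass of f reduces the claim to a pointwise comparison of integrands;
   multiplied by e^(-t) it becomes 1 - t <= e^(-t). *)
rewrite [leLHS](_ : 0 = ruelle f Bn (fun=> 1) x - \int[leb]_a f a); last first.
  by rewrite ruelle_normalized1 Rintegral_prior// subrr.
rewrite /ruelle -RintegralB//; apply: le_Rintegral => //.
- exact: (integrableB measurableT i1 if1).
- exact: (ruelle_integrable x bcn bcn).
move=> a _; set t := Bn _; rewrite mulr1 -[X in _ - X]mul1r -mulrBl.
apply: ler_wpM2r; first exact: ltW.
rewrite lerBlDr -lerBlDl -[X in X - _]mulr1 -mulrBr.
by rewrite -(ler_pM2l (expR_gt0 (- t))) mulrA -expRD addNr expR0 mul1r mulr1 expR_ge1Dx.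
Qed.

(** The duality is tested on the normalized potential itself, whose coboundary part has zero
    integral by invariance. *)
Lemma eigenvalue_le (mu : probability (borel_seqsp R) R) :
  shift_invariant mu -> is_dual_ruelle f Bn mu mu -> ln lambda <= \int[mu]_x B x.
Proof.
move=> inv dual; have bcV := bounded_continuous_ln_eigenfunction.
have iB := bounded_continuous_integrable mu bcB.
have iV := bounded_continuous_integrable mu bcV.
have bcVs := bounded_continuous_comp_shift bcV.
have iVs := bounded_continuous_integrable mu bcVs.
have icst r := bounded_continuous_integrable mu (bounded_continuous_cst r).
have : 0 <= \int[mu]_x Bn x.
  by rewrite (dual _ bounded_continuous_normalized); exact: Rintegral_ge0.
rewrite /normalized_potential !RintegralB//; last 2 first.
- exact: (bounded_continuous_integrable mu (bounded_continuousD bcB bcV)).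
- exact: (bounded_continuous_integrable mu (bounded_continuousD
    (bounded_continuousD bcB bcV) (bounded_continuousN bcVs))).
rewrite RintegralD// Rintegral_probability_cst (shift_invariant_Rintegral inv bcV).
lra.
Qed.

End eigenfunction.
End ruelle_operator.

(** * Comparison of Gibbs states with invariant measures, and the limit *)

Lemma gibbs_state_almost_maximizing (R : realType) (alpha : R) (f : R -> R)
    (A : seqsp R -> R) : 0 < alpha ->
  (forall a, 0 < f a) -> continuous f ->
  (\int[@lebesgue_measure R]_a (f a)%:E = 1)%E -> hoelder_fun alpha A ->
  forall e, 0 < e -> exists K, forall beta (mu eta : probability (borel_seqsp R) R),
    0 < beta -> gibbs_state alpha f (fun x => beta * A x) mu ->
    shift_invariant eta ->
    \int[eta]_x A x <= \int[mu]_x A x + e + K / beta.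
Proof.
move=> alpha0 f0 cf f1 hA e e0.
have bcA := hoelder_bounded_continuous alpha0 hA.
have [C C0 hC] := hoelder_fun_gt0 hA.
have q1 : 0 < 1 - contraction alpha by rewrite subr_gt0 contraction_lt1.
pose D := C / (1 - contraction alpha); have D0 : 0 < D by rewrite divr_gt0.
(* Solves D (delta / (2 pi))^alpha = e. The Hölder constant of beta A is beta C, so the error in
   [eigenvalue_ge] is then exactly beta e, with delta independent of beta. *)
pose delta := (e / D) `^ alpha^-1 * (pi * 2).
have pi20 : 0 < pi * 2 :> R by rewrite mulr_gt0// pi_gt0.
have delta0 : 0 < delta by rewrite mulr_gt0// powR_gt0// divr_gt0.
have deltaE : D * (delta / (pi * 2)) `^ alpha = e.
  rewrite mulfK ?gt_eqF// -powRrM mulVf ?gt_eqF// powRr1 ?divr_ge0 ?ltW//.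
  by rewrite mulrC divfK// gt_eqF.
have [m m0 hm] := prior_mass_gt0 f0 cf f1 delta0.
(* [m] is fixed before beta, so dividing by beta leaves ln m as the only term that decays. *)
exists (- ln m) => beta mu eta beta0 [inv [lambda [psi [eigenpair dual]]]] inveta.
have [lambda0 psi0 hpsi eigen] := eigenpair.
have bcB := bounded_continuousZ beta bcA.
have bcpsi := hoelder_bounded_continuous alpha0 hpsi.
have hB x y : `|beta * A x - beta * A y| <= beta * C * mdist x y `^ alpha.
  by rewrite -mulrBr normrM gtr0_norm// -mulrA ler_pM2l.
have betaC0 : 0 <= beta * C by rewrite mulr_ge0 ?ltW.
have up := eigenvalue_le f0 cf f1 lambda0 psi0 eigen bcB bcpsi inv dual.
have lo := eigenvalue_ge alpha0 f0 cf f1 lambda0 psi0 eigen bcB bcpsi betaC0 hB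
  hpsi inveta m0 hm.
have EE : beta * C / (1 - contraction alpha) * (delta / (pi * 2)) `^ alpha =
    beta * e.
  by rewrite -deltaE /D !mulrA.
have := le_trans lo up; rewrite EE !RintegralZl//;
  try exact: bounded_continuous_integrable.
move=> h; rewrite -(ler_pM2l beta0) !mulrDr [beta * (_ / _)]mulrC divfK ?gt_eqF//.
lra.
Qed.

Theorem lemma2p9 (R : realType) (alpha : R) (f : R -> R)
    (alpha_gt0 : 0 < alpha) (alpha_le1 : alpha <= 1)
    (f_gt0 : forall a, 0 < f a) (f_cont : continuous f)
    (f_int1 : (\int[@lebesgue_measure R]_a (f a)%:E = 1)%E)
    (A : seqsp R -> R) (A_hoelder : hoelder_fun alpha A)
    (mu_ : R -> probability (borel_seqsp R) R)
    (mu_gibbs : forall beta, 0 < beta ->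
       gibbs_state alpha f (fun x => beta * A x) (mu_ beta))
    (mu_infty : probability (borel_seqsp R) R)
    (mu_accum : accumulation_at_infinity mu_ mu_infty) :
  maximizing A mu_infty.
Proof.
have [beta [beta_gt0 beta_oo cv]] := mu_accum.
have bcA := hoelder_bounded_continuous alpha_gt0 A_hoelder.
have inv_infty : shift_invariant mu_infty.
  by apply: weak_limit_shift_invariant cv => n; have [] := mu_gibbs _ (beta_gt0 n).
(* For fixed e, the sequence beta_n tends to infinity first; e is arbitrary afterwards. *)
have upper eta : shift_invariant eta -> \int[eta]_x A x <= \int[mu_infty]_x A x.
  move=> inv_eta; apply/ler_addgt0Pr => e e_gt0.
  have [K hK] := gibbs_state_almost_maximizing alpha_gt0 f_gt0 f_cont f_int1
    A_hoelder e_gt0.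
  have betaV : (beta n)^-1 @[n --> \oo] --> 0.
    by apply/gtr0_cvgV0 => //; exact: nearW.
  have lim : \int[mu_ (beta n)]_x A x + e + K / beta n @[n --> \oo] -->
             \int[mu_infty]_x A x + e + K * 0.
    apply: cvgD; last exact: cvgMr betaV.
    by apply: cvgD; [exact: cv|exact: cvg_cst].
  rewrite mulr0 addr0 in lim.
  apply: (ler_cvg_to _ lim); first exact: cvg_cst.
  by apply: nearW => n; apply: hK => //; exact: mu_gibbs.
split => //; apply/eqP; rewrite eq_le; apply/andP; split.
  (* A real supremum is meaningful only for a nonempty set bounded above: [upper] supplies the bound
     and [mu_infty] a member. *)
  apply: ub_le_sup; last by exists mu_infty.
  by exists (\int[mu_infty]_x A x) => _ [eta inv_eta ->]; exact: upper.
apply: ge_sup; first by exists (\int[mu_infty]_x A x), mu_infty.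
by move=> _ [eta inv_eta ->]; exact: upper.
Qed.
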